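(* Let $(V,e)$ be a unital $\ast$-normed space, let $\varepsilon>1/\|e\|$, put $S_{\varepsilon}=V_{he}^{\ast}\cap\varepsilon\operatorname{ball}V^{\ast}$ and $\mathfrak{c}_{\varepsilon}=\{v\in V_h:\langle v,\varphi\rangle\ge 0\ \forall\varphi\in S_{\varepsilon}\}$. Then $\mathfrak{c}_{\varepsilon}$ is a separated, closed, unital cone in $V$ whose state space satisfies $S(\mathfrak{c}_{\varepsilon})=S_{\varepsilon}$, and $(V,\mathfrak{c}_{\varepsilon})$ is a concrete function system on $S_{\varepsilon}$ whose $\varepsilon$-norm $\|v\|_{\varepsilon}=\sup\{|\langle v,\varphi\rangle|:\varphi\in S_{\varepsilon}\}$ is equivalent to the original norm of $V$.
   Context: A $\ast$-normed space is a complex vector space $V$ with an involution and a norm with $\|v^{\ast}\|=\|v\|$. $V_h$ is the real space of hermitian elements; $V^{\ast}$ has involution $\langle v,\varphi^{\ast}\rangle=\overline{\langle v^{\ast},\varphi\rangle}$, and $V_h^{\ast}$ is the set of bounded hermitian functionals. For nonzero $e\in V_h$, $V_{he}^{\ast}=\{y\in V_h^{\ast}:\langle e,y\rangle=1\}$; $(V,e)$ is a unital $\ast$-normed space if $V_{he}^{\ast}\cap\operatorname{ball}V^{\ast}\neq\varnothing$. A cone $\mathfrak{c}\subseteq V_h$ is separated if $\mathfrak{c}\cap(-\mathfrak{c})=\{0\}$, unital if for every $v\in V_h$ there is $r\ge0$ with $v+re\in\mathfrak{c}$; its state space is $S(\mathfrak{c})=\{\varphi:V\to\mathbb{C}\text{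 linear}:\langle\mathfrak{c},\varphi\rangle\ge0,\ \langle e,\varphi\rangle=1\}$. ''$(V,\mathfrak{c})$ is a concrete function system on $K$'' (with $K$ a weak$^*$-compact set of states carrying the weak$^*$ topology) means that the unital $\ast$-linear map $\Phi:V\to C(K)$, $\Phi(v)(\varphi)=\langle v,\varphi\rangle$, is an isometry from $(V,\sup_{\varphi\in K}|\langle\cdot,\varphi\rangle|)$ onto its range and an order isomorphism onto its range: $\Phi(\mathfrak{c})=\Phi(V_h)\cap C(K)_+$. *)

(* Defs.v *)
(* MathComp + MathComp-Analysis; complex numbers are
   mathcomp-real-closed's [R[i]] over an abstract [R : realType]. *)
From HB Require Import structures.
From mathcomp Require Import all_boot all_order all_algebra complex.
From mathcomp Require Import all_classical all_reals all_analysis.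
Import Order.TTheory GRing.Theory Num.Theory.
Import numFieldNormedType.Exports.
Set Implicit Arguments. Unset Strict Implicit. Unset Printing Implicit Defensive.
Local Open Scope ring_scope.
Local Open Scope classical_set_scope.

Section StarNormed.
Context {R : realType} {V : lmodType R[i]}.
Variables (star : V -> V) (nrm : V -> R).

(** modulus of a complex number, as a real number *)
Definition cmod (z : R[i]) : R := Normc.normc z.

(** (V, star, nrm) is a *-normed space: [star] is a conjugate-linear
    involution, [nrm] is a norm (w.r.t. the complex modulus) and
    ||v*|| = ||v||. *)
Definition star_normed_space : Prop :=
  (forall v, star (star v) = v) /\
  (forall (a : R[i]) u v, star (a *: u + v) = a^* *: star u + star v) /\
  (forall v, 0 <= nrm v) /\ (forall v, nrm v = 0 -> v = 0) /\
  (forall (a : R[i]) v, nrm (a *: v) = cmod a * nrm v) /\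
  (forall u v, nrm (u + v) <= nrm u + nrm v) /\
  (forall v, nrm (star v) = nrm v).

(** hermitian elements V_h *)
Definition hermitian (v : V) : Prop := star v = v.

(** linear functionals V -> C *)
Definition lin_functional (f : V -> R[i]) : Prop :=
  forall (a : R[i]) u v, f (a *: u + v) = a * f u + f v.

(** bounded linear functionals (elements of V^* ) *)
Definition bounded_functional (f : V -> R[i]) : Prop :=
  lin_functional f /\ exists M : R, forall v, cmod (f v) <= M * nrm v.

(** the involution on V^*: <v, f^*> = conj <v^*, f> ; hermitian iff f^* = f *)
Definition fstar (f : V -> R[i]) : V -> R[i] := fun v => (f (star v))^*.

(** V_h^* : bounded hermitian functionals *)
Definition herm_functional (f : V -> R[i]) : Prop :=
  bounded_functional f /\ fstar f = f.

(** V_he^* *)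
Definition Vhe (e : V) : set (V -> R[i]) :=
  [set f | herm_functional f /\ f e = 1].

(** r ball V^* : bounded functionals of dual norm at most r
    (||f|| <= r  iff  |f v| <= r ||v|| for all v) *)
Definition dual_ball (r : R) : set (V -> R[i]) :=
  [set f | bounded_functional f /\ forall v, cmod (f v) <= r * nrm v].

(** (V, e) is a unital *-normed space *)
Definition unital_star_normed (e : V) : Prop :=
  [/\ star_normed_space, hermitian e, e <> 0 & Vhe e `&` dual_ball 1 !=set0].

(** cones in V (contained in V_h) *)
Definition is_cone (c : set V) : Prop :=
  [/\ c 0, c `<=` hermitian,
      (forall u v, c u -> c v -> c (u + v))
    & (forall (r : R) v, 0 <= r -> c v -> c ((r%:C)%C *: v))].

Definition separated_cone (c : set V) : Prop :=
  c `&` [set v | c (- v)] `<=` [set 0].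

(** closedness w.r.t. the norm topology of V *)
Definition norm_closed (c : set V) : Prop :=
  forall v, (forall d : R, 0 < d -> exists w, c w /\ nrm (v - w) < d) -> c v.

Definition unital_cone (e : V) (c : set V) : Prop :=
  forall v, hermitian v -> exists r : R, 0 <= r /\ c (v + (r%:C)%C *: e).

(** state space S(c) *)
Definition state_space (e : V) (c : set V) : set (V -> R[i]) :=
  [set f | [/\ lin_functional f, (forall v, c v -> 0 <= f v) & f e = 1]].

(** weak-* topology: topology of pointwise convergence on functionals *)
Definition weakstar_compact (K : set (V -> R[i])) : Prop :=
  @compact {ptws V -> R[i]^o} K.

(** (V, c) is a concrete function system on K : the map
    Phi : V -> C(K), Phi v phi = phi v, is well defined (continuous on K for
    the weak-* topology), unital, *-linear, an isometry from
    (V, sup_{phi in K} |phi .|) onto its range (i.e. injective, so that this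
    sup is a norm and Phi is an isometric embedding) and an order
    isomorphism onto its range: Phi(c) = Phi(V_h) \cap C(K)_+ . *)
Definition concrete_function_system (e : V) (c : set V)
    (K : set (V -> R[i])) : Prop :=
  K `<=` state_space e c /\
  weakstar_compact K /\
  (forall v, {within (K : set {ptws V -> R[i]^o}), continuous
               ((fun f : {ptws V -> R[i]^o} => (f v : R[i]^o)))}) /\
  (forall f, K f -> f e = 1) /\
  (forall v f, K f -> f (star v) = (f v)^*) /\
  (forall v, (forall f, K f -> f v = 0) -> v = 0) /\
  (forall v, c v -> hermitian v /\ forall f, K f -> 0 <= f v) /\
  (forall v, hermitian v -> (forall f, K f -> 0 <= f v) ->
     exists w, c w /\ forall f, K f -> f w = f v).

(** sup-norm over a set K of functionals *)
Definition supnorm (K : set (V -> R[i])) (v : V) : R :=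
  sup [set cmod (f v) | f in K].

End StarNormed.

(** S_eps = V_he^* \cap eps ball V^* *)
Definition S_eps {R : realType} {V : lmodType R[i]} (star : V -> V)
  (nrm : V -> R) (e : V) (eps : R) : set (V -> R[i]) :=
  Vhe star nrm e `&` dual_ball nrm eps.

(** c_eps = { v in V_h : <v, phi> >= 0 for all phi in S_eps } *)
Definition c_eps {R : realType} {V : lmodType R[i]} (star : V -> V)
  (nrm : V -> R) (e : V) (eps : R) : set V :=
  [set v | hermitian star v /\ forall f, S_eps star nrm e eps f -> 0 <= f v].

(* Main.v *)
(** A functional f0 in V_he^* of norm 1/||e|| exists by Hahn-Banach.  Since
    eps > 1/||e||, it can be perturbed inside S_eps towards a functional norming
    a given hermitian v, so S_eps detects ||v|| up to a constant; this gives
    separation and the equivalence of norms.  Unitality of the cone comes with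
    the explicit constant eps ||v||, which in turn bounds every state by eps on
    hermitian elements, hence everywhere by a rotation argument.  Compactness
    of S_eps is Tychonoff's theorem for a product of disks. *)
Require Import Defs.
From HB Require Import structures.
From mathcomp Require Import all_boot all_order all_algebra complex.
From mathcomp Require Import all_classical all_reals all_analysis.
From mathcomp Require Import ring lra.
Import Order.TTheory GRing.Theory Num.Theory.
Import numFieldNormedType.Exports.
Set Implicit Arguments.
Unset Strict Implicit.
Unset Printing Implicit Defensive.
Local Open Scope ring_scope.
Local Open Scope classical_set_scope.

(** * Real Hahn-Banach theorem by way of minimal sublinear functionals *)

Section HahnBanach.
Context {R : realType} {U : lmodType R}.
Implicit Types (p q : U -> R) (x y : U).

Definition sublinear p :=
  (forall x y, p (x + y) <= p x + p y) /\
  (forall (t : R) x, 0 < t -> p (t *: x) = t * p x).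

Lemma sublinear0 p : sublinear p -> p 0 = 0.
Proof.
move=> [_ hZ]; have := hZ 2 0 (ltr0n _ 2); rewrite scaler0 => h; lra.
Qed.

(** The reverse inequality is the same bound for [t^-1] at [t *: x], so an infimum has to be
    estimated on one side only. *)
Lemma pos_homogeneous_le p :
  (forall (t : R) x, 0 < t -> p (t *: x) <= t * p x) ->
  forall (t : R) x, 0 < t -> p (t *: x) = t * p x.
Proof.
move=> sub t x t0; apply/eqP; rewrite eq_le sub //= -ler_pdivlMl //.
have {1}-> : x = t^-1 *: (t *: x) by rewrite scalerA mulVf ?scale1r ?lt0r_neq0.
by rewrite sub ?invr_gt0.
Qed.

Lemma sublinear_opp p x : sublinear p -> - p (- x) <= p x.
Proof.
move=> hp; have := hp.1 x (- x); rewrite subrr sublinear0 // => h; lra.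
Qed.

(* q x is the infimum over t >= 0 of p (x + t y) - t p y; take t = 1 at - y. *)
Lemma sublinear_refine p y : sublinear p ->
  exists q, [/\ sublinear q, forall x, q x <= p x & q (- y) <= - p y].
Proof.
move=> hp; have p0 := sublinear0 hp; case: (hp) => pD pZ.
have pZ0 t x : 0 <= t -> p (t *: x) = t * p x.
  by rewrite le_eqVlt => /predU1P[<-|/pZ//]; rewrite scale0r mul0r.
pose E x := [set p (x + t *: y) - t * p y | t in [set t | 0 <= t]].
have lbE x : lbound (E x) (- p (- x)).
  move=> _ [t /= t0 <-].
  have := pD (x + t *: y) (- x).
  by rewrite addrAC subrr add0r pZ0 //; lra.
have hE x : has_lbound (E x) by exists (- p (- x)).
have nE x : E x !=set0 by exists (p (x + 0 *: y) - 0 * p y), 0 => /=.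
have qle x t : 0 <= t -> inf (E x) <= p (x + t *: y) - t * p y.
  by move=> t0; apply: ge_inf => //; exists t.
exists (fun x => inf (E x)); split; first split.
- move=> x1 x2.
  rewrite -lerBlDr; apply: lb_le_inf => // _ [s /= s0 <-].
  rewrite lerBlDr -lerBlDl; apply: lb_le_inf => // _ [t /= t0 <-].
  (* Parameters [s] for [x1] and [t] for [x2] combine to the admissible parameter [s + t] for
     [x1 + x2]. *)
  rewrite lerBlDr; apply: le_trans (qle _ (s + t) _) _; first exact: addr_ge0.
  have := pD (x1 + s *: y) (x2 + t *: y).
  by rewrite addrACA -scalerDl; lra.
- have sub t x : 0 < t -> inf (E (t *: x)) <= t * inf (E x).
    move=> t0; rewrite -ler_pdivrMl //; apply: lb_le_inf => // _ [s /= s0 <-].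
    rewrite ler_pdivrMl //; apply: le_trans (qle _ (t * s) _) _.
      by rewrite mulr_ge0 // ltW.
    by rewrite -scalerA -scalerDr pZ //; lra.
  exact: pos_homogeneous_le.
- by move=> x; have := qle x 0 (lexx _); rewrite scale0r addr0 mul0r subr0.
- by have := qle (- y) 1 ler01; rewrite scale1r addNr p0 mul1r sub0r.
Qed.

(** Zorn's lemma for the reversed pointwise order, whose maximal elements are the minimal
    functionals; a nonempty chain is bounded by its pointwise infimum. *)
Lemma minimal_sublinear p : sublinear p ->
  exists q, [/\ sublinear q, forall x, q x <= p x &
    forall q', sublinear q' -> (forall x, q' x <= q x) -> q' = q].
Proof.
move=> hp.
pose T := {q : U -> R | sublinear q /\ forall x, q x <= p x}.
pose r : rel T := fun a b => `[< forall x, sval b x <= sval a x >].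
have rP (a b : T) : reflect (forall x, sval b x <= sval a x) (r a b).
  exact: asboolP.
have [| | | |[q [hq qp]] qmin] := @Zorn T r.
- by move=> a; apply/rP.
- move=> a b c /rP ab /rP bc; apply/rP => x.
  exact: le_trans (bc x) (ab x).
- move=> [a ha] [b hb] /rP ab /rP ba; apply: eq_exist => /=.
  by apply/funext => x; apply/eqP; rewrite eq_le ba ab.
(* The empty chain is bounded by [p], since [inf] of the empty set is only a default value. *)
- move=> A totA; have [->|/set0P[a0 Aa0]] := eqVneq A set0.
    by exists (exist _ p (conj hp (fun x => lexx (p x)))).
  pose E x := [set sval a x | a in A].
  have hE x : has_lbound (E x).
    exists (- p (- x)) => _ [a Aa <-].
    have [ha /(_ (- x)) ap] := svalP a.
    have := sublinear_opp x ha; lra.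
  have nE x : E x !=set0 by exists (sval a0 x), a0.
  have qle x a : A a -> inf (E x) <= sval a x.
    by move=> Aa; apply: ge_inf => //; exists a.
  suff hq : sublinear (fun x => inf (E x)).
    have qp x : inf (E x) <= p x.
      by apply: le_trans (qle x a0 Aa0) _; have [_] := svalP a0.
    pose a1 : T := exist _ (fun x => inf (E x)) (conj hq qp).
    by exists a1 => a Aa; apply/rP => x; exact: qle.
  split.
  + move=> x y; rewrite -lerBlDr; apply: lb_le_inf => // _ [a Aa <-].
    rewrite lerBlDr -lerBlDl; apply: lb_le_inf => // _ [b Ab <-].
    rewrite lerBlDr; have [[aD _] _] := svalP a; have [[bD _] _] := svalP b.
    (* The smaller of [a] and [b] can be used at both points. *)
    have [/rP ab|/rP ba] := totA _ _ Aa Ab.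
      apply: le_trans (qle _ b Ab) _; apply: le_trans (bD _ _) _.
      have := ab x; lra.
    apply: le_trans (qle _ a Aa) _; apply: le_trans (aD _ _) _.
    have := ba y; lra.
  + have sub t x : 0 < t -> inf (E (t *: x)) <= t * inf (E x).
      move=> t0; rewrite -ler_pdivrMl //; apply: lb_le_inf => // _ [a Aa <-].
      rewrite ler_pdivrMl //; have [[_ aZ] _] := svalP a.
      by rewrite -aZ //; exact: qle.
    exact: pos_homogeneous_le.
exists q; split=> // q' hq' q'q.
have q'p x : q' x <= p x by exact: le_trans (q'q x) (qp x).
pose a : T := exist _ q' (conj hq' q'p).
have /qmin[//] : r (exist _ q (conj hq qp)) a by apply/rP.
Qed.

(* Minimal sublinear functionals are linear: refining one in the direction y
   gives nothing new, so it is odd at y. *)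
Lemma hahn_banach p x0 : sublinear p ->
  exists g : U -> R, [/\ forall (t : R) x y, g (t *: x + y) = t * g x + g y,
    forall x, g x <= p x & g x0 = p x0].
Proof.
(* Everything below [p1] is at most [- p x0] at [- x0], so a linear functional below [p1] attains
   [p x0] at [x0]. *)
move=> hp; have [p1 [hp1 p1p p1x0]] := sublinear_refine x0 hp.
have [g [hg gp1 gmin]] := minimal_sublinear hp1.
have gN y : g (- y) = - g y.
  have [q [hq qg qy]] := sublinear_refine y hg.
  have gq := gmin q hq qg; rewrite gq in qy.
  by have := sublinear_opp y hg; lra.
have gD x y : g (x + y) = g x + g y.
  case: hg => gD _; apply/eqP; rewrite eq_le gD /=.
  (* Oddness turns subadditivity at [x + y] and [- y] into the reverse inequality. *)
  by have := gD (x + y) (- y); rewrite addrK gN; lra.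
have gp x : g x <= p x by exact: le_trans (gp1 x) (p1p x).
exists g; split=> //; last first.
  by have := le_trans (gp1 (- x0)) p1x0; rewrite gN; have := gp x0; lra.
move=> t x y; rewrite gD; congr (_ + _); case: (hg) => _ gZ.
have [t0|t0|->] := ltgtP t 0.
- have := gZ (- t) x; rewrite scaleNr gN oppr_gt0 mulNr => /(_ t0); lra.
- exact: gZ.
- by rewrite scale0r mul0r; exact: sublinear0.
Qed.

End HahnBanach.

(** * Modulus, conjugation and order of complex numbers *)

Section Complex.
Context {R : realType}.
Implicit Types z w : R[i].

Lemma normr_Re_le_cmod z : `|complex.Re z| <= cmod z.
Proof.
case: z => a b /=; rewrite -sqrtr_sqr ler_sqrt ?lerDl ?sqr_ge0 //.
by rewrite addr_ge0 ?sqr_ge0.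
Qed.

Lemma normr_Im_le_cmod z : `|complex.Im z| <= cmod z.
Proof.
case: z => a b /=; rewrite -sqrtr_sqr ler_sqrt ?lerDr ?sqr_ge0 //.
by rewrite addr_ge0 ?sqr_ge0.
Qed.

Lemma cmod_ge0 z : 0 <= cmod z.
Proof. by case: z => a b; exact: sqrtr_ge0. Qed.

Lemma cmod_real (x : R) : cmod x%:C%C = `|x|.
Proof. by rewrite /cmod /= expr0n addr0 sqrtr_sqr. Qed.

Lemma cmodM z w : cmod (z * w) = cmod z * cmod w.
Proof. exact: Normc.normcM. Qed.

Lemma cmodD z w : cmod (z + w) <= cmod z + cmod w.
Proof. exact: le_normcD. Qed.

Lemma cmod_le_ReIm z : cmod z <= `|complex.Re z| + `|complex.Im z|.
Proof.
rewrite [z in cmod z]complexE; apply: le_trans (cmodD _ _) _.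
have i1 : cmod ('i%C : R[i]) = 1 by rewrite /cmod /= expr0n expr1n add0r sqrtr1.
by rewrite cmodM !cmod_real i1 mul1r.
Qed.

Lemma cmodN z : cmod (- z) = cmod z.
Proof. exact: normcN. Qed.

Lemma cmod_conj z : cmod z^* = cmod z.
Proof. by case: z => a b; rewrite /cmod /= sqrrN. Qed.

Lemma ReD z w : complex.Re (z + w) = complex.Re z + complex.Re w.
Proof. by case: z; case: w. Qed.

Lemma ReN z : complex.Re (- z) = - complex.Re z.
Proof. by case: z. Qed.

(** Bridge between the library norm, which takes values in [R[i]], and the real-valued [cmod]. *)
Lemma normr_cmod z : `|z| = (cmod z)%:C%C.
Proof. by case: z. Qed.

Lemma rotation z : exists w, cmod w = 1 /\ w * z = (cmod z)%:C%C.
Proof.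
have [->|z0] := eqVneq z 0.
  by exists 1; rewrite mulr0 /cmod Normc.normc0 Normc.normc1.
have mz0 : cmod z != 0 by apply: contra_neq z0; exact: Normc.eq0_normc.
exists ((cmod z)%:C%C / z); split; last by rewrite divfK.
by rewrite cmodM cmod_real ger0_norm ?cmod_ge0 // /cmod Normc.normcV divff.
Qed.

Lemma conj_real (t : R) : (t%:C%C : R[i])^* = t%:C%C.
Proof. exact: conjc_real. Qed.

Lemma conjD z w : (z + w)^* = z^* + w^*.
Proof. exact: rmorphD. Qed.

Lemma conjB z w : (z - w)^* = z^* - w^*.
Proof. exact: rmorphB. Qed.

Lemma conjM z w : (z * w)^* = z^* * w^*.
Proof. exact: rmorphM. Qed.

Lemma conj_conj z : z^*^* = z.
Proof. exact: conjcK. Qed.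

(** Nonnegativity in [R[i]] includes being real; this is what makes states hermitian later on. *)
Lemma ge0_complex z : (0 <= z) = (complex.Im z == 0) && (0 <= complex.Re z).
Proof. by rewrite lecE. Qed.

End Complex.

(** * Compact disks, and closed conditions for pointwise convergence *)

Section ComplexTopology.
Context {R : realType}.

Lemma near_cmod (z : R[i]^o) (d : R) : 0 < d ->
  \forall w \near z, cmod (z - w : R[i]) < d.
Proof.
move=> d0; have d0' : 0 < d%:C%C :> R[i] by rewrite ltcR.
have /cvgrPdist_lt/(_ _ d0') : (fun w : R[i]^o => w) @ z --> z by exact: cvg_id.
by apply: filterS => w /=; rewrite normr_cmod ltcR.
Qed.

Lemma cvg_cmod {T : Type} (F : set_system T) {FF : Filter F}
    (f : T -> R[i]^o) (l : R[i]^o) :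
  (forall d : R, 0 < d -> \forall x \near F, cmod (l - f x : R[i]) < d) ->
  f @ F --> l.
Proof.
(* A positive radius in [R[i]] has zero imaginary part, so real radii suffice. *)
move=> h; apply/cvgrPdist_lt => -[a b]; rewrite ltcE /= => /andP[/eqP -> a0].
by apply: filterS (h a a0) => x; rewrite normr_cmod complexr0 ltcR.
Qed.

Lemma continuous_cmod : continuous (fun z : R[i]^o => cmod (z : R[i]) : R^o).
Proof.
move=> z; apply/(@cvgrPdist_lt _ _ _ (nbhs z)) => d d0.
apply: filterS (near_cmod z d0) => w zw.
apply: le_lt_trans zw; rewrite ler_norml; apply/andP; split.
  have := cmodD (z : R[i]) (w - z : R[i]).
  by rewrite addrC subrK -(cmodN (w - z)) opprB; lra.
have := cmodD (z - w : R[i]) (w : R[i]).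
by rewrite subrK; lra.
Qed.

Lemma continuous_conj : continuous (fun z : R[i]^o => (z : R[i])^* : R[i]^o).
Proof.
move=> z; apply: (@cvg_cmod _ (nbhs z)) => d d0.
apply: filterS (near_cmod z d0) => w.
by rewrite -rmorphB cmod_conj.
Qed.

Lemma continuous_Complex :
  continuous (fun p : R^o * R^o => Complex p.1 p.2 : R[i]^o).
Proof.
move=> [a b]; apply: (@cvg_cmod _ (nbhs (a, b))) => d d0.
have d2 : 0 < d / 2 by rewrite divr_gt0.
have /cvgrPdist_lt/(_ _ d2) ha :
  (fun p : R^o * R^o => p.1) @ (a, b) --> a by exact: cvg_fst.
have /cvgrPdist_lt/(_ _ d2) hb :
  (fun p : R^o * R^o => p.2) @ (a, b) --> b by exact: cvg_snd.
apply: filterS2 ha hb => -[x y] /= ax bY.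
by apply: le_lt_trans (cmod_le_ReIm (Complex _ _)) _; rewrite [d]splitr ltrD.
Qed.

(** Compactness comes from real segments: the square is the continuous image of a product of two of
    them. *)
Lemma compact_square (r : R) :
  compact [set z : R[i]^o | `|complex.Re z| <= r /\ `|complex.Im z| <= r].
Proof.
have := @continuous_compact _ _ _ (`[- r, r] `*` `[- r, r])
  (continuous_subspaceT continuous_Complex)
  (compact_setX (@segment_compact _ (- r) r) (@segment_compact _ (- r) r)).
congr compact; apply/seteqP; split=>
    [_ [[a b] [/= ha hb] <-] /=|[a b] /= [ha hb]].
  by move: ha hb; rewrite !in_itv /= !ler_norml.
by exists (a, b) => //=; rewrite !in_itv /= -!ler_norml.
Qed.

Lemma closed_cmod_le (r : R) : closed [set z : R[i]^o | cmod (z : R[i]) <= r].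
Proof.
apply: (@preimage_closed _ _ _ [set x : R^o | x <= r]); last exact: closed_le.
by move=> z _; exact: continuous_cmod.
Qed.

Lemma compact_disk (r : R) : compact [set z : R[i]^o | cmod (z : R[i]) <= r].
Proof.
apply: subclosed_compact (@closed_cmod_le r) (@compact_square r) _ => z /= zr.
by split; [exact: le_trans (normr_Re_le_cmod _) zr
          |exact: le_trans (normr_Im_le_cmod _) zr].
Qed.

Context {V : lmodType R[i]}.
Variables (star : V -> V).

Lemma continuous_eval (v : V) :
  continuous (fun f : {ptws V -> R[i]^o} => f v : R[i]^o).
Proof. exact: (@proj_continuous V (fun=> R[i]^o) v). Qed.

(** Linearity, hermiticity and normalization at [e] are all intersections of such zero sets, with
    [F] built from evaluations. *)
Lemma closed_zero_set (F : {ptws V -> R[i]^o} -> R[i]^o) :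
  continuous F -> closed [set f | F f = 0].
Proof.
move=> cF; apply: (@preimage_closed _ _ F [set 0]).
  by move=> f _; exact: cF.
by apply: compact_closed (@compact_set1 _ _); exact: norm_hausdorff.
Qed.

Lemma closed_lin_functional :
  closed [set f : {ptws V -> R[i]^o} | lin_functional (f : V -> R[i])].
Proof.
have -> : [set f : {ptws V -> R[i]^o} | lin_functional (f : V -> R[i])] =
    \bigcap_(p : R[i] * V * V) [set f | f (p.1.1 *: p.1.2 + p.2)
       - ((p.1.1 *: f p.1.2 : R[i]^o) + f p.2) = 0].
  apply/seteqP; split=> [f hf [[a u] v] _ /=|f hf a u v].
    by apply/eqP; rewrite subr_eq0; apply/eqP; exact: hf.
  by have /= /eqP := hf (a, u, v) I; rewrite subr_eq0 => /eqP.
apply: closed_bigI => -[[a u] v] _.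
apply: (@closed_zero_set (fun f : {ptws V -> R[i]^o} =>
  f (a *: u + v) - ((a *: f u : R[i]^o) + f v) : R[i]^o)) => f.
apply: (@cvgB _ _ _ (nbhs f)); first exact: continuous_eval.
apply: (@cvgD _ _ _ (nbhs f)); last exact: continuous_eval.
by apply: (@cvgZr _ _ _ (nbhs f)); exact: continuous_eval.
Qed.

Lemma closed_star_functional :
  closed [set f : {ptws V -> R[i]^o} | forall v, f (star v) = (f v : R[i])^*].
Proof.
have -> : [set f : {ptws V -> R[i]^o} | forall v, f (star v) = (f v : R[i])^*] =
    \bigcap_v [set f | f (star v) - ((f v : R[i])^* : R[i]^o) = 0].
  apply/seteqP; split=> [f hf v _ /=|f hf v].
    by apply/eqP; rewrite subr_eq0; apply/eqP; exact: hf.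
  by have /= /eqP := hf v I; rewrite subr_eq0 => /eqP.
apply: closed_bigI => v _.
apply: (@closed_zero_set (fun f : {ptws V -> R[i]^o} =>
  f (star v) - ((f v : R[i])^* : R[i]^o) : R[i]^o)) => f.
apply: (@cvgB _ _ _ (nbhs f)); first exact: continuous_eval.
apply: (@continuous_comp _ _ _ (fun f : {ptws V -> R[i]^o} => f v : R[i]^o)
  (fun z : R[i]^o => (z : R[i])^* : R[i]^o)).
  exact: continuous_eval.
exact: continuous_conj.
Qed.

Lemma closed_eval_eq (v : V) (c : R[i]) :
  closed [set f : {ptws V -> R[i]^o} | f v = c].
Proof.
have -> : [set f : {ptws V -> R[i]^o} | f v = c] =
    [set f | f v - (c : R[i]^o) = 0].
  by apply/seteqP; split=> f /= /eqP; [|]; rewrite ?subr_eq0 => /eqP // ->;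
    rewrite subrr.
apply: (@closed_zero_set (fun f : {ptws V -> R[i]^o} =>
  f v - (c : R[i]^o) : R[i]^o)) => f.
by apply: (@cvgB _ _ _ (nbhs f)); [exact: continuous_eval|exact: cvg_cst].
Qed.

End ComplexTopology.

(** * The real vector space underlying a complex one *)

Definition restrict_scalars {R : realType} (V : lmodType R[i]) : Type := V.

Section RestrictScalars.
Context {R : realType} {V : lmodType R[i]}.
Local Notation VR := (restrict_scalars V).

(** The alias keeps the real action apart from the complex one, so that the real Hahn-Banach theorem
    applies to the vectors of [V]. *)
HB.instance Definition _ := GRing.Zmodule.on VR.

Let scaleR (t : R) (v : VR) : VR := (t%:C)%C *: (v : V).

Let scaleRA (s t : R) (v : VR) : scaleR s (scaleR t v) = scaleR (s * t) v.
Proof. by rewrite /scaleR scalerA -rmorphM. Qed.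

Let scaleR1 : left_id 1 scaleR.
Proof. by move=> v; rewrite /scaleR rmorph1 scale1r. Qed.

Let scaleRDr : right_distributive scaleR +%R.
Proof. by move=> t u v; rewrite /scaleR scalerDr. Qed.

Let scaleRDl (v : VR) : {morph scaleR^~ v : s t / s + t}.
Proof. by move=> s t; rewrite /scaleR rmorphD scalerDl. Qed.

HB.instance Definition _ :=
  GRing.Zmodule_isLmodule.Build R VR scaleRA scaleR1 scaleRDr scaleRDl.

Lemma restrict_scalarsZ (t : R) (v : VR) : t *: v = (t%:C)%C *: (v : V).
Proof. by []. Qed.

End RestrictScalars.

(** * Algebra of complex-linear functionals *)

Section LinFunctional.
Context {R : realType} {V : lmodType R[i]}.
Implicit Types (f : V -> R[i]) (a : R[i]) (u v : V).

Lemma lin0 f : lin_functional f -> f 0 = 0.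
Proof.
by move=> hf; have := hf (-1) 0 0; rewrite scaler0 addr0 mulN1r addNr.
Qed.

Lemma linD f u v : lin_functional f -> f (u + v) = f u + f v.
Proof. by move=> hf; rewrite -[u]scale1r hf mul1r scale1r. Qed.

Lemma linZ f a v : lin_functional f -> f (a *: v) = a * f v.
Proof. by move=> hf; rewrite -[a *: v]addr0 hf lin0 // addr0. Qed.

Lemma linN f v : lin_functional f -> f (- v) = - f v.
Proof. by move=> hf; rewrite -scaleN1r linZ // mulN1r. Qed.

Lemma linB f u v : lin_functional f -> f (u - v) = f u - f v.
Proof. by move=> hf; rewrite linD // linN. Qed.

End LinFunctional.

(** * Hermitian parts, and Hahn-Banach for hermitian functionals *)

Definition star_functional {R : realType} {V : lmodType R[i]} (star : V -> V)
  (f : V -> R[i]) := forall v, f (star v) = (f v)^*.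

Definition herm_part {R : realType} {V : lmodType R[i]} (star : V -> V)
  (v : V) : V := (2^-1)%:C%C *: (v + star v).

Section StarNormedSpace.
Context {R : realType} {V : lmodType R[i]} {star : V -> V} {nrm : V -> R}.
Context (sn : star_normed_space star nrm).
Implicit Types (f : V -> R[i]) (a : R[i]) (u v : V).

Lemma starK v : star (star v) = v.
Proof. by case: sn. Qed.

Lemma nrm_ge0 v : 0 <= nrm v.
Proof. by case: sn => _ [_ [? _]]. Qed.

Lemma nrm0_eq0 v : nrm v = 0 -> v = 0.
Proof. by case: sn => _ [_ [_ [+ _]]]; exact. Qed.

Lemma nrmZ a v : nrm (a *: v) = cmod a * nrm v.
Proof. by case: sn => _ [_ [_ [_ [-> _]]]]. Qed.

Lemma nrmD u v : nrm (u + v) <= nrm u + nrm v.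
Proof. by case: sn => _ [_ [_ [_ [_ [+ _]]]]]; exact. Qed.

Lemma nrm_star v : nrm (star v) = nrm v.
Proof. by case: sn => _ [_ [_ [_ [_ [_ +]]]]]; exact. Qed.

Lemma nrmN v : nrm (- v) = nrm v.
Proof. by rewrite -scaleN1r nrmZ cmodN /cmod Normc.normc1 mul1r. Qed.

Lemma nrm_gt0 v : v <> 0 -> 0 < nrm v.
Proof.
move=> v0; rewrite lt_neqAle nrm_ge0 andbT eq_sym.
by apply/eqP => /nrm0_eq0.
Qed.

Lemma starD u v : star (u + v) = star u + star v.
Proof.
case: sn => _ [h _]; rewrite -[u]scale1r h scale1r.
by rewrite (_ : 1^* = 1) ?scale1r // rmorph1.
Qed.

Lemma star0 : star 0 = 0.
Proof.
by have /(congr1 (+%R^~ (- star 0))) := starD 0 0; rewrite addr0 addrK subrr.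
Qed.

Lemma starZ a v : star (a *: v) = a^* *: star v.
Proof. by case: sn => _ [h _]; rewrite -[a *: v]addr0 h star0 addr0. Qed.

Lemma starN v : star (- v) = - star v.
Proof. by rewrite -scaleN1r starZ rmorphN rmorph1 scaleN1r. Qed.

Lemma starZr (t : R) v : star ((t%:C)%C *: v) = (t%:C)%C *: star v.
Proof. by rewrite starZ conj_real. Qed.

Lemma hermitian_herm_part v : Defs.hermitian star (herm_part star v).
Proof. by rewrite /Defs.hermitian /herm_part starZr starD starK addrC. Qed.

Lemma herm_part_id v : Defs.hermitian star v -> herm_part star v = v.
Proof.
move=> hv; rewrite /herm_part hv -[v in v + v]scale1r -scalerDl scalerA.
rewrite (_ : _ * _ = 1) ?scale1r //; apply/eqP; rewrite eq_complex /=.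
by apply/andP; split; apply/eqP; field.
Qed.

(** Cartesian decomposition: the second hermitian part is the imaginary part of [v], namely
    [v - star v] divided by 2i. *)
Lemma herm_decomp v :
  v = herm_part star v + 'i%C *: herm_part star ((- 'i%C) *: v).
Proof.
rewrite /herm_part starZ !scalerDr !scalerA addrACA -!scalerDl.
rewrite [X in X *: v](_ : _ = 1) ?scale1r; last first.
  by apply/eqP; rewrite eq_complex /=; apply/andP; split; apply/eqP; field.
rewrite [X in X *: star v](_ : _ = 0) ?scale0r ?addr0 //.
by apply/eqP; rewrite eq_complex /=; apply/andP; split; apply/eqP; field.
Qed.

Lemma nrm_herm_part v : nrm (herm_part star v) <= nrm v.
Proof.
rewrite nrmZ cmod_real ger0_norm ?invr_ge0 //.
have := nrmD v (star v); rewrite nrm_star; lra.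
Qed.

Lemma nrm_imag v : nrm ((- 'i%C) *: v) = nrm v.
Proof.
by rewrite nrmZ cmodN /cmod /= expr0n expr1n add0r sqrtr1 mul1r.
Qed.

Lemma functional_herm_part f v : lin_functional f -> star_functional star f ->
  f (herm_part star v) = (complex.Re (f v))%:C%C.
Proof.
move=> hl hs; rewrite linZ // linD // hs; case: (f v) => x y.
by apply/eqP; rewrite eq_complex /=; apply/andP; split; apply/eqP; field.
Qed.

Lemma functional_hermitian f v : lin_functional f -> star_functional star f ->
  Defs.hermitian star v -> f v = (complex.Re (f v))%:C%C.
Proof. by move=> hl hs hv; rewrite -functional_herm_part // herm_part_id. Qed.

(* Rotating f v to its modulus lets the hermitian part of the rotated vector
   carry the whole value. *)
Lemma functional_bound_hermitian f (C : R) :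
  0 <= C -> lin_functional f -> star_functional star f ->
  (forall v, Defs.hermitian star v -> cmod (f v) <= C * nrm v) ->
  forall v, cmod (f v) <= C * nrm v.
Proof.
move=> C0 hl hs hC v; have [w [w1 wf]] := rotation (f v).
have := hC _ (hermitian_herm_part (w *: v)).
rewrite functional_herm_part // linZ // wf cmod_real /= ger0_norm ?cmod_ge0 //.
move=> /le_trans; apply; apply: ler_wpM2l => //.
by apply: le_trans (nrm_herm_part _) _; rewrite nrmZ w1 mul1r.
Qed.

(** Over the reals [nrm] is sublinear; the real functional it dominates is the real part of a
    complex-linear one. *)
Lemma star_normed_hahn_banach v0 : Defs.hermitian star v0 ->
  exists f, [/\ lin_functional f, star_functional star f,
    forall v, cmod (f v) <= nrm v & f v0 = (nrm v0)%:C%C].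
Proof.
move=> hv0.
have hp : sublinear (nrm : restrict_scalars V -> R).
  split; first exact: nrmD.
  by move=> t v t0; rewrite restrict_scalarsZ nrmZ cmod_real gtr0_norm.
have [g [glin gle gv0]] := hahn_banach (v0 : restrict_scalars V) hp.
(* The complexification h of g need not be hermitian; averaging it with its
   adjoint does not change the value at the hermitian v0. *)
pose h v : R[i] := Complex (g v) (- g ('i%C *: v)).
have g0 : g 0 = 0.
  by have := glin (-1) 0 0; rewrite scaler0 addr0 mulN1r addNr.
have gD (u v : V) : g (u + v) = g u + g v.
  by have := glin 1 u v; rewrite mul1r scale1r.
have gZ t (v : V) : g ((t%:C)%C *: v) = t * g v.
  by have := glin t v 0; rewrite g0 !addr0.
(* Reduces complex scalars to real ones and to multiplication by i, as [g] is only real-linear. *)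
have decomp a v : a *: v =
    (complex.Re a)%:C%C *: v + (complex.Im a)%:C%C *: ('i%C *: v).
  by rewrite scalerA -scalerDl mulrC -complexE.
have hlin : lin_functional h.
  move=> a u v; rewrite /h.
  have -> : g (a *: u + v) =
      complex.Re a * g u + complex.Im a * g ('i%C *: u) + g v.
    by rewrite gD decomp gD !gZ.
  have -> : g ('i%C *: (a *: u + v)) =
      - complex.Im a * g u + complex.Re a * g ('i%C *: u) + g ('i%C *: v).
    rewrite scalerDr gD scalerA decomp gD !gZ; congr (_ * _ + _ * _ + _).
      by case: a => x y /=; ring.
    by case: a => x y /=; ring.
  by case: a => x y; apply/eqP; rewrite eq_complex /=; apply/andP; split;
    apply/eqP; ring.
have hle v : cmod (h v) <= nrm v.
  (* After rotation the value of [h] equals its real part, a value of [g], which the norm bounds. *)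
  have [w [w1 wh]] := rotation (h v).
  have := gle (w *: v); rewrite nrmZ w1 mul1r; apply: le_trans.
  have -> : g (w *: v) = complex.Re (h (w *: v)) by [].
  by rewrite linZ // wh.
pose f v := (2^-1)%:C%C * (h v + (h (star v))^*).
have flin : lin_functional f.
  move=> a u v; rewrite /f starD starZ hlin (hlin (a^*)).
  have -> (x y : R[i]) : (a^* * x + y)^* = a * x^* + y^*.
    by rewrite conjD conjM conj_conj.
  ring.
have fstar : star_functional star f.
  move=> v; rewrite /f starK conjM conjD.
  by rewrite conj_real conj_conj addrC.
exists f; split=> //.
- move=> v; rewrite /f cmodM cmod_real ger0_norm ?invr_ge0 //.
  have := cmodD (h v) (h (star v))^*; rewrite cmod_conj.
  by have := hle v; have := hle (star v); rewrite nrm_star; lra.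
(* The imaginary part of [h v0] cancels in the average, leaving [g v0]. *)
- rewrite /f hv0 /h gv0.
  by apply/eqP; rewrite eq_complex /=; apply/andP; split; apply/eqP; field.
Qed.

End StarNormedSpace.

(** * The set [S_eps], its norming property and its cone *)

Section EpsilonCone.
Context {R : realType} {V : lmodType R[i]} {star : V -> V} {nrm : V -> R}.
Context {e : V} {eps : R}.
Context (hu : unital_star_normed star nrm e) (heps : (nrm e)^-1 < eps).
Implicit Types (f : V -> R[i]) (u v : V).

Local Notation S := (S_eps star nrm e eps).
Local Notation c := (c_eps star nrm e eps).

Let sn : star_normed_space star nrm. Proof. by case: hu. Qed.
Let he : Defs.hermitian star e. Proof. by case: hu. Qed.
Let e_gt0 : 0 < nrm e. Proof. by apply: (nrm_gt0 sn); case: hu. Qed.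
Let eps_gt0 : 0 < eps.
Proof. by apply: lt_trans heps; rewrite invr_gt0. Qed.

(** Working form of membership: [fstar f = f] becomes a pointwise identity, and boundedness is part
    of the bound by [eps]. *)
Lemma S_epsP f : S f <-> [/\ lin_functional f, star_functional star f, f e = 1
  & forall v, cmod (f v) <= eps * nrm v].
Proof.
split=> [[[[[fl _] fs] fe] [_ fb]]|[fl fs fe fb]].
  by split=> // v; rewrite -{2}fs /fstar conj_conj.
have bf : bounded_functional nrm f by split=> //; exists eps.
split=> //; split=> //; split=> //; apply/funext => v.
by rewrite /fstar fs conj_conj.
Qed.

(** Hermitian functionals are real on hermitian elements, so positivity can be tested on real
    parts. *)
Lemma c_eps_ge0 v : c v <->
  Defs.hermitian star v /\ forall f, S f -> 0 <= complex.Re (f v).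
Proof.
split=> -[hv h]; split=> // f Sf; have := h f Sf; rewrite ge0_complex.
  by case/andP.
have /S_epsP[fl fs _ _] := Sf.
by rewrite (functional_hermitian fl fs hv) /= eqxx.
Qed.

(** A functional norming [e], divided by ||e||; its norm is the least one compatible with the value
    1 at [e]. *)
Lemma S_eps_min_norm : exists f, [/\ lin_functional f, star_functional star f,
  f e = 1 & forall v, cmod (f v) <= (nrm e)^-1 * nrm v].
Proof.
have [g [gl gs gb ge]] := star_normed_hahn_banach sn he.
exists (fun v => (nrm e)^-1%:C%C * g v); split.
- by move=> a u v; rewrite gl; ring.
- by move=> v; rewrite gs conjM conj_real.
- by rewrite ge -rmorphM mulVf ?rmorph1 // gt_eqF.
- move=> v; rewrite cmodM cmod_real ger0_norm ?invr_ge0 ?(ltW e_gt0) //.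
  by rewrite ler_wpM2l // invr_ge0 ltW.
Qed.

Lemma S_eps_nonempty : S !=set0.
Proof.
have [f [fl fs fe fb]] := S_eps_min_norm; exists f; apply/S_epsP; split=> // v.
by apply: le_trans (fb v) _; rewrite ler_wpM2r ?(nrm_ge0 sn) // ltW.
Qed.

(* The slack eps - 1/||e|| leaves room to perturb a functional f0 of minimal
   norm in the direction of a functional g norming v, corrected by g e f0 so as
   to keep the value 1 at e. *)
Lemma S_eps_norming : exists2 K : R, 0 < K &
  forall v (N : R), (forall f, S f -> cmod (f v) <= N) -> nrm v <= K * N.
Proof.
have [f0 [f0l f0s f0e f0b]] := S_eps_min_norm.
(* The correction [g - g e f0] has norm at most 2, so half of the slack keeps [f] in the
   [eps]-ball. *)
pose t := (eps - (nrm e)^-1) / 2.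
have t0 : 0 < t by rewrite divr_gt0 // subr_gt0.
have Sf0 : S f0.
  apply/S_epsP; split=> // v; apply: le_trans (f0b v) _.
  by rewrite ler_wpM2r ?(nrm_ge0 sn) ?(ltW heps).
(* Solving the definition of [f] for [g v] = ||v|| gives t ||v|| <= N + N + t ||e|| N. *)
pose K := (2 + t * nrm e) / t.
have K0 : 0 < K by rewrite divr_gt0 // addr_gt0 // mulr_gt0.
have herm v N : Defs.hermitian star v -> (forall f, S f -> cmod (f v) <= N) ->
    nrm v <= K * N.
  move=> hv hN; have [g [gl gs gb gv]] := star_normed_hahn_banach sn hv.
  pose f u := f0 u + t%:C%C * (g u - g e * f0 u).
  have Sf : S f.
    apply/S_epsP; split.
    - by move=> a x y; rewrite /f f0l gl; ring.
    (* [g e] is real because [e] is hermitian. *)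
    - move=> x; rewrite /f f0s gs (functional_hermitian gl gs he).
      by rewrite conjD conjM conjB conjM !conj_real.
    - by rewrite /f f0e mulr1 subrr mulr0 addr0.
    - move=> x; apply: le_trans (cmodD _ _) _.
      rewrite cmodM cmod_real gtr0_norm //.
      have h1 : cmod (g x - g e * f0 x) <= 2 * nrm x.
        apply: le_trans (cmodD _ _) _; rewrite cmodN cmodM.
        have : cmod (g e) * cmod (f0 x) <= nrm e * ((nrm e)^-1 * nrm x).
          by rewrite ler_pM ?cmod_ge0.
        rewrite mulrA divff ?gt_eqF // mul1r; have := gb x; lra.
      have := f0b x; have : t * cmod (g x - g e * f0 x) <= t * (2 * nrm x).
        by rewrite ler_wpM2l // ltW.
      have -> : t * (2 * nrm x) = (eps - (nrm e)^-1) * nrm x.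
        by rewrite mulrA divfK.
      lra.
  have E : (t * nrm v)%:C%C = f v - f0 v + t%:C%C * g e * f0 v.
    by rewrite rmorphM /= -gv /f; ring.
  have Et : cmod (f v - f0 v + t%:C%C * g e * f0 v) = t * nrm v.
    by rewrite -E cmod_real ger0_norm // mulr_ge0 ?(nrm_ge0 sn) ?(ltW t0).
  rewrite /K mulrAC ler_pdivlMr // mulrC -Et.
  apply: le_trans (cmodD _ _) _; rewrite mulrDl lerD //.
    apply: le_trans (cmodD _ _) _; rewrite cmodN.
    by have := hN _ Sf; have := hN _ Sf0; lra.
  rewrite !cmodM cmod_real gtr0_norm //; apply: ler_pM; last exact: hN.
  - by rewrite mulr_ge0 ?cmod_ge0 // ltW.
  - exact: cmod_ge0.
  - by rewrite ler_wpM2l // ltW.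
(* For general [v] the real and imaginary parts are each bounded by [K * N], hence the factor 2. *)
exists (2 * K); first by rewrite mulr_gt0.
move=> v N hN; rewrite {1}(herm_decomp sn v).
apply: le_trans (nrmD sn _ _) _.
have -> : 2 * K * N = K * N + K * N by ring.
have part u : (forall f, S f -> cmod (f u) <= N) ->
    nrm (herm_part star u) <= K * N.
  move=> uN; apply: herm; first exact: hermitian_herm_part sn _.
  move=> f Sf; have /S_epsP[fl fs _ _] := Sf; rewrite functional_herm_part //.
  rewrite cmod_real; apply: le_trans (normr_Re_le_cmod _) _; exact: uN.
have ni w : nrm ('i%C *: w) = nrm w.
  by rewrite -(nrm_imag sn) scalerA mulNr -expr2 sqr_i opprK scale1r.
rewrite ni lerD //; apply: part => // f Sf; have /S_epsP[fl _ _ _] := Sf.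
rewrite linZ // cmodM cmodN (_ : cmod 'i%C = 1) ?mul1r; first exact: hN.
by rewrite /cmod /= expr0n expr1n add0r sqrtr1.
Qed.

(** The case [N = 0] of [S_eps_norming]. *)
Lemma S_eps_separates v : (forall f, S f -> f v = 0) -> v = 0.
Proof.
move=> h; have [K K0 hK] := S_eps_norming; apply: (nrm0_eq0 sn).
apply/eqP; rewrite eq_le (nrm_ge0 sn) andbT -(mulr0 K); apply: hK => f Sf.
by rewrite h // /cmod Normc.normc0.
Qed.

Lemma supnorm_ge v f : S f -> cmod (f v) <= supnorm S v.
Proof.
move=> Sf; apply: ub_le_sup; last by exists f.
by exists (eps * nrm v) => _ [g /S_epsP[_ _ _ gb] <-].
Qed.

Lemma supnorm_le v : supnorm S v <= eps * nrm v.
Proof.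
apply: ge_sup; first by have [f Sf] := S_eps_nonempty; exists (cmod (f v)), f.
by move=> _ [g /S_epsP[_ _ _ gb] <-].
Qed.

(** * Cone properties: separated, closed, unital *)

Lemma is_cone_c_eps : is_cone star c.
Proof.
split.
- apply/c_eps_ge0; split; first exact: star0 sn.
  by move=> f /S_epsP[fl _ _ _]; rewrite lin0.
- by move=> v [].
- move=> u v /c_eps_ge0[hu1 pu] /c_eps_ge0[hv pv]; apply/c_eps_ge0; split.
    by rewrite /Defs.hermitian (starD sn) hu1 hv.
  move=> f Sf; have /S_epsP[fl _ _ _] := Sf; rewrite linD // ReD.
  exact: addr_ge0 (pu f Sf) (pv f Sf).
- move=> r v r0 /c_eps_ge0[hv pv]; apply/c_eps_ge0; split.
    by rewrite /Defs.hermitian (starZr sn) hv.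
  move=> f Sf; have /S_epsP[fl _ _ _] := Sf; rewrite linZ //.
  by have := pv f Sf; case: (f v) => x y /= x0; rewrite mul0r subr0 mulr_ge0.
Qed.

Lemma separated_c_eps : separated_cone c.
Proof.
move=> v [/= /c_eps_ge0[hv pv] /c_eps_ge0[_ nv]].
apply: S_eps_separates => f Sf; have /S_epsP[fl fs _ _] := Sf.
rewrite (functional_hermitian fl fs hv).
have := nv f Sf; have := pv f Sf; rewrite linN // ReN => p n.
by rewrite (_ : complex.Re (f v) = 0) //; lra.
Qed.

Lemma norm_closed_c_eps : norm_closed nrm c.
Proof.
move=> v hv; apply/c_eps_ge0; split.
  (* The limit is hermitian: for hermitian [w], the norm of [star v - v] is at most 2 ||v - w||,
     hence the radius [d / 2]. *)
  apply/eqP; rewrite -subr_eq0; apply/eqP/(nrm0_eq0 sn)/eqP.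
  rewrite eq_le (nrm_ge0 sn) andbT; apply/ler_addgt0Pl => d d0; rewrite addr0.
  have [|w [[hw _] wd]] := hv (d / 2); first by rewrite divr_gt0.
  have -> : star v - v = star (v - w) - (v - w).
    by rewrite (starD sn) (starN sn) (hw : star w = w) opprB addrA subrK.
  apply: le_trans (nrmD sn _ _) _; rewrite (nrmN sn) (nrm_star sn); lra.
move=> f Sf; have /S_epsP[fl _ _ fb] := Sf.
rewrite leNgt; apply/negP => fv0.
(* For [w] this close, |f (v - w)| < - Re (f v), which forces Re (f w) < 0. *)
have [|w [/c_eps_ge0[_ pw] wd]] := hv (- complex.Re (f v) / eps).
  by rewrite divr_gt0 // oppr_gt0.
have := pw f Sf; rewrite ltr_pdivlMr // mulrC in wd.
have := fb (v - w); have := normr_Re_le_cmod (f (v - w)).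
rewrite linB // ReD ReN ler_norml => /andP[]; lra.
Qed.

(** Each [f] in [S] has Re (f v) >= - eps ||v||, and the added multiple of [e] contributes exactly
    eps ||v||. *)
Lemma c_eps_shift v : Defs.hermitian star v -> c (v + (eps * nrm v)%:C%C *: e).
Proof.
move=> hv; apply/c_eps_ge0; split.
  by rewrite /Defs.hermitian (starD sn) (starZr sn) hv he.
move=> f /S_epsP[fl _ fe fb]; rewrite linD // linZ // fe mulr1 ReD /=.
have := fb v; have := normr_Re_le_cmod (f v); rewrite ler_norml => /andP[]; lra.
Qed.

Lemma unital_c_eps : unital_cone star e c.
Proof.
move=> v hv; exists (eps * nrm v); split; last exact: c_eps_shift.
by rewrite mulr_ge0 ?(nrm_ge0 sn) // ltW.
Qed.

(** * State space, weak-* compactness and the function system *)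

Lemma S_eps_sub_state_space : S `<=` state_space e c.
Proof.
by move=> f Sf; have /S_epsP[fl _ fe _] := Sf; split=> // v [_]; exact.
Qed.

(* v + eps ||v|| e lies in the cone for every hermitian v, so a state is
   automatically bounded by eps: no separation theorem is needed. *)
Lemma state_space_c_eps : state_space e c = S.
Proof.
apply/seteqP; split=> [f [fl fp fe]|]; last exact: S_eps_sub_state_space.
(* Positivity at the shifted vector gives both facts: its value is real and the shift is real, so
   [f v] is real too. *)
have key v : Defs.hermitian star v ->
    f v = (complex.Re (f v))%:C%C /\ - (eps * nrm v) <= complex.Re (f v).
  move=> hv; have := fp _ (c_eps_shift hv); rewrite linD // linZ // fe mulr1.
  rewrite ge0_complex; case: (f v) => x y /= /andP[/eqP y0 x0].
  by split; [apply/eqP; rewrite eq_complex /= eqxx /=; apply/eqP|]; lra.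
have fs : star_functional star f.
  move=> v.
  (* Being real on hermitian elements, [f] respects the star by the Cartesian decomposition. *)
  have [a [b [ha hb ->]]] : exists a b : V, [/\ star a = a, star b = b &
      v = a + 'i%C *: b].
    exists (herm_part star v), (herm_part star ((- 'i%C) *: v)).
    by split; [exact: hermitian_herm_part sn _|exact: hermitian_herm_part sn _|
      exact: herm_decomp sn v].
  rewrite (starD sn) (starZ sn) ha hb !(linD _ _ fl) !(linZ _ _ fl) conjD conjM.
  by rewrite (key a ha).1 (key b hb).1 !conj_real.
apply/S_epsP; split=> //.
apply: (functional_bound_hermitian sn) => //; first exact: ltW.
move=> v hv; have [-> lo] := key v hv; rewrite cmod_real ler_norml lo /=.
(* The upper bound is the lower bound at [- v]. *)
have hN : Defs.hermitian star (- v).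
  by rewrite /Defs.hermitian (starN sn) (hv : star v = v).
by have [_] := key _ hN; rewrite linN // ReN (nrmN sn); lra.
Qed.

(** Banach-Alaoglu argument: closed conditions cut [S] out of the product of the disks of radius eps
    ||v||. *)
Lemma weakstar_compact_S_eps : weakstar_compact S.
Proof.
have := compact_closedI (compact_closedI (compact_closedI
  (@tychonoff V (fun=> R[i]^o) _ (fun v => @compact_disk R (eps * nrm v)))
  (@closed_lin_functional R V)) (@closed_star_functional R V star))
  (@closed_eval_eq R V e 1).
congr compact; apply/seteqP; split=> f.
  by move=> [[[fb fl] fs] fe]; apply/S_epsP.
by move=> /S_epsP[fl fs fe fb].
Qed.

Lemma concrete_function_system_c_eps : concrete_function_system star e c S.
Proof.
split; first exact: S_eps_sub_state_space.
split; first exact: weakstar_compact_S_eps.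
split; first by move=> v; apply: continuous_subspaceT; exact: continuous_eval.
split; first by move=> f /S_epsP[].
split; first by move=> v f /S_epsP[].
split; first exact: S_eps_separates.
by split=> [v []|v hv pv] //; exists v.
Qed.

Lemma supnorm_S_eps_equiv : exists m M : R, [/\ 0 < m, 0 < M &
  forall v, m * nrm v <= supnorm S v <= M * nrm v].
Proof.
(* The lower constant is the norming property with [N] = [supnorm S v]; the upper one is the radius
   of the dual ball. *)
have [K K0 hK] := S_eps_norming; exists K^-1, eps; split=> //.
  by rewrite invr_gt0.
move=> v; rewrite supnorm_le andbT ler_pdivrMl //.
by apply: hK => f; exact: supnorm_ge.
Qed.

End EpsilonCone.

Theorem theorem4p5 (R : realType) (V : lmodType R[i]) (star : V -> V)
    (nrm : V -> R) (e : V) (eps : R) :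
  unital_star_normed star nrm e ->
  (nrm e)^-1 < eps ->
  let c := c_eps star nrm e eps in
  let S := S_eps star nrm e eps in
  is_cone star c /\ separated_cone c /\ norm_closed nrm c /\
  unital_cone star e c /\
  state_space e c = S /\
  concrete_function_system star e c S /\
  (exists m M : R, [/\ 0 < m, 0 < M &
      forall v, m * nrm v <= supnorm S v <= M * nrm v]).
Proof.
move=> hu heps c S; split; first exact: is_cone_c_eps.
split; first exact: separated_c_eps.
split; first exact: norm_closed_c_eps.
split; first exact: unital_c_eps.
split; first exact: state_space_c_eps.
split; first exact: concrete_function_system_c_eps.
exact: supnorm_S_eps_equiv.
Qed.
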